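(* Let $K$ be a field of characteristic zero, let $n\ge 1$, and let $F=(F_1,\dots,F_n):K^n\to K^n$ be a polynomial map of the form $F_i(X_1,\dots,X_n)=X_i+H_i(X_1,\dots,X_n)$ for $i=1,\dots,n$, where each $H_i\in K[X_1,\dots,X_n]$ has order of vanishing at least $2$. If $F$ is strongly nilpotent, then $F$ is Pascal finite.
   Context: A polynomial map $F:K^n\to K^n$ is a tuple $F=(F_1,\dots,F_n)$ of polynomials $F_i\in K[X]=K[X_1,\dots,X_n]$; composition means substitution of polynomials. The order of vanishing of a polynomial is the lowest total degree of a monomial occurring in it; thus ''order of vanishing at least $2$'' means that all monomials of $H_i$ have total degree at least $2$ (the zero polynomial is allowed). Strongly nilpotent: write $F=\mathrm{Id}+H$ with $H=(H_1,\dots,H_n)$ and let $J_H=(\partial H_i/\partial X_j)_{1\le i,j\le n}$ be the Jacobian matrix of $H$. Let $Y^{(1)}=(Y^{(1)}_1,\dots,Y^{(1)}_n),\dots,Y^{(n)}=(Y^{(n)}_1,\dots,Y^{(n)}_n)$ be $n$ sets of $n$ independent variables. The matrix $J_H$ is strongly nilpotent if the product $J_H(Y^{(1)})\cdots J_H(Y^{(n)})$ is the zero matrix (over the polynomial ring $K[Y^{(i)}_j: 1\le i,j\le n]$). The map $F=\mathrm{Id}+H$ is called strongly nilpotent if $J_H$ is strongly nilpotent. Pascal finite: for a polynomial map $F$ define $\Delta_F:K[X]^n\to K[X]^n$ by $\Delta_F(P)=P\circ F-P$. The map $F$ is Pascal finite if there exists a positive integer $m$ such that $\Delta_F^m(X)=0$,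 where $\Delta_F^m$ is the $m$-fold iterate of $\Delta_F$ and $X=(X_1,\dots,X_n)$ is the identity map. *)

(* Defs.v *)
From HB Require Import structures.
From mathcomp Require Import all_boot all_order all_algebra.
From mathcomp Require Import mpoly.

Set Implicit Arguments.
Unset Strict Implicit.
Unset Printing Implicit Defensive.

Import GRing.Theory.
Local Open Scope ring_scope.

Definition polymap (K : fieldType) (n : nat) : Type := n.-tuple {mpoly K[n]}.

Definition polymap_id (K : fieldType) (n : nat) : polymap K n :=
  [tuple 'X_i | i < n].

Definition polymap_zero (K : fieldType) (n : nat) : polymap K n :=
  [tuple 0 | i < n].

Definition polymap_sub (K : fieldType) (n : nat) (P Q : polymap K n) :
    polymap K n :=
  [tuple tnth P i - tnth Q i | i < n].

Definition polymap_comp (K : fieldType) (n : nat) (P F : polymap K n) :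
    polymap K n :=
  [tuple tnth P i \mPo F | i < n].

(* The zero polynomial satisfies this for every d. *)
Definition vanishing_order_ge (K : fieldType) (n d : nat) (p : {mpoly K[n]}) :
    Prop :=
  forall m : 'X_{1..n}, m \in msupp p -> (d <= mdeg m)%N.

Definition jacobian (K : fieldType) (n : nat) (H : polymap K n) :
    'M[{mpoly K[n]}]_n :=
  \matrix_(i < n, j < n) (tnth H i)^`M(j).

(* The n * n independent variables are those of {mpoly K[n * n]}, the j-th one
   of the k-th block being indexed by the bijection mxvec_index. *)
Definition var_block (K : fieldType) (n : nat) (k : 'I_n) :
    n.-tuple {mpoly K[n * n]} :=
  [tuple 'X_(mxvec_index k j) | j < n].

Definition mx_at_block (K : fieldType) (n : nat) (A : 'M[{mpoly K[n]}]_n)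
    (k : 'I_n) : 'M[{mpoly K[n * n]}]_n :=
  map_mx (fun p : {mpoly K[n]} => p \mPo var_block K k) A.

Definition strongly_nilpotent_mx (K : fieldType) (n : nat)
    (A : 'M[{mpoly K[n]}]_n) : Prop :=
  \big[mulmx/1%:M]_(k < n) mx_at_block A k = 0.

(* With F = Id + H, the matrix below is the Jacobian of H = F - Id. *)
Definition strongly_nilpotent (K : fieldType) (n : nat) (F : polymap K n) :
    Prop :=
  strongly_nilpotent_mx (jacobian (polymap_sub F (polymap_id K n))).

Definition Delta (K : fieldType) (n : nat) (F P : polymap K n) : polymap K n :=
  polymap_sub (polymap_comp P F) P.

Definition pascal_finite (K : fieldType) (n : nat) (F : polymap K n) : Prop :=
  exists m : nat,
    (0 < m)%N /\ iter m (Delta F) (polymap_id K n) = polymap_zero K n.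

(* Main.v *)
(** A row vector [v] with [v J(Y1) ... J(Yk) = 0] gives a linear form [l_v]
    killed by a power of [Delta : p |-> p o F - p], by induction on [k]:
    - The polynomials killed by a power of [Delta] form a subalgebra, since
      [Delta (p q) = Delta p q + p Delta q + Delta p Delta q].
    - [Delta l_v = v . H] has gradient [v J], and extracting the coefficients in
      [Y1] shows that every coefficient vector [w] of [v J] satisfies
      [w J(Y2) ... J(Yk) = 0], so [l_w] lies in the subalgebra.
    - In characteristic 0, Euler's identity, by induction on the degree, puts
      in this subalgebra every polynomial whose gradient has its coefficient
      vectors in a space of [w] with [l_w] in the subalgebra; so [v . H] is.
    Strong nilpotency is the case [k = n], where every [v] is allowed. *)

Require Import Defs.
From HB Require Import structures.
From mathcomp Require Import all_boot all_order all_algebra.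
From mathcomp Require Import mpoly ring.

Import GRing.Theory.
Local Open Scope ring_scope.

(** * Elements killed by a power of a difference operator *)

Definition diff {R : comNzRingType} (f : {rmorphism R -> R}) (x : R) : R :=
  f x - x.

Definition diff_nil {R : comNzRingType} (f : {rmorphism R -> R}) (x : R) :
    Prop :=
  exists m : nat, iter m (diff f) x = 0.

Lemma iter_diffD {R : comNzRingType} (f : {rmorphism R -> R}) m x y :
  iter m (diff f) (x + y) = iter m (diff f) x + iter m (diff f) y.
Proof. by elim: m => //= m ->; rewrite /diff rmorphD opprD addrACA. Qed.

Lemma iter_diff0 {R : comNzRingType} (f : {rmorphism R -> R}) m :
  iter m (diff f) 0 = 0.
Proof. by elim: m => //= m ->; rewrite /diff rmorph0 subr0. Qed.

Lemma iter_diff_leq {R : comNzRingType} (f : {rmorphism R -> R}) m k x :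
  (m <= k)%N -> iter m (diff f) x = 0 -> iter k (diff f) x = 0.
Proof. by move=> /subnK <- mx; rewrite iterD mx iter_diff0. Qed.

Lemma diffM {R : comNzRingType} (f : {rmorphism R -> R}) x y :
  diff f (x * y) = diff f x * y + x * diff f y + diff f x * diff f y.
Proof. by rewrite /diff rmorphM; ring. Qed.

(** Induction on [a + b]: each term of [diffM] lowers at least one of the two exponents. *)
Lemma iter_diffM {R : comNzRingType} (f : {rmorphism R -> R}) a b x y :
  iter a (diff f) x = 0 -> iter b (diff f) y = 0 ->
  iter (a + b) (diff f) (x * y) = 0.
Proof.
move: {2}(a + b)%N (erefl (a + b)%N) => s.
elim: s a b x y => [|s IHs] a b x y.
  by case: a => //= _ -> _; rewrite mul0r iter_diff0.
case: a => [|a]; first by move=> _ /= -> _; rewrite mul0r iter_diff0.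
case: b => [|b]; first by move=> _ _ y0; rewrite (y0 : y = 0) mulr0 iter_diff0.
move=> sE xa yb; have {}sE : (a + b.+1)%N = s by case: sE.
rewrite addSn iterSr diffM !iter_diffD.
rewrite iterSr in xa; have yb' := yb; rewrite iterSr in yb'.
have -> := IHs _ _ _ _ sE xa yb.
(* [diff f y] dies after [b] iterations; [b] is relaxed to [b.+1] so that the exponents still add up
   to [s]. *)
have -> := IHs _ _ _ _ sE xa (iter_diff_leq f _ _ _ (leqnSn b) yb').
rewrite -addSnnS in sE *.
by rewrite (IHs a.+1 b) ?iterSr // !addr0.
Qed.

Lemma diff_nilD {R : comNzRingType} (f : {rmorphism R -> R}) x y :
  diff_nil f x -> diff_nil f y -> diff_nil f (x + y).
Proof.
move=> [a xa] [b yb]; exists (a + b)%N; rewrite iter_diffD.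
rewrite (iter_diff_leq f a) ?leq_addr // (iter_diff_leq f b) ?leq_addl //.
exact: addr0.
Qed.

Lemma diff_nilM {R : comNzRingType} (f : {rmorphism R -> R}) x y :
  diff_nil f x -> diff_nil f y -> diff_nil f (x * y).
Proof. by move=> [a xa] [b yb]; exists (a + b)%N; apply: iter_diffM. Qed.

Lemma diff_nil_sum {R : comNzRingType} (f : {rmorphism R -> R})
    (I : Type) (r : seq I) (P : pred I) (F : I -> R) :
  (forall i, P i -> diff_nil f (F i)) -> diff_nil f (\sum_(i <- r | P i) F i).
Proof.
move=> nilF; apply: big_ind => //; first by exists 0%N.
exact: diff_nilD.
Qed.

Lemma diff_nilC {K : fieldType} {n : nat} (F : polymap K n) (c : K) :
  diff_nil (comp_mpoly F) c%:MP.
Proof. by exists 1%N; rewrite /= /diff /= comp_mpolyC subrr. Qed.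

Lemma diff_nilZ {K : fieldType} {n : nat} (F : polymap K n) (c : K) p :
  diff_nil (comp_mpoly F) p -> diff_nil (comp_mpoly F) (c *: p).
Proof. by rewrite -mul_mpolyC; apply/diff_nilM/diff_nilC. Qed.

(** * Linear forms, Euler's operator and gradients *)

Definition linear_form {K : fieldType} {n : nat} (v : 'rV[K]_n) :
    {mpoly K[n]} := \sum_i v 0 i *: 'X_i.

Lemma linear_form_mulmx {K : fieldType} {m n : nat} (v : 'rV[K]_m)
    (B : 'M[K]_(m, n)) :
  linear_form (v *m B) = \sum_i v 0 i *: linear_form (row i B).
Proof.
rewrite /linear_form; under [RHS]eq_bigr do rewrite scaler_sumr.
rewrite exchange_big; apply: eq_bigr => j _ /=.
rewrite mxE scaler_suml; apply: eq_bigr => i _.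
by rewrite mxE scalerA.
Qed.

Lemma linear_form_sum {K : fieldType} {n : nat} (I : finType)
    (v : I -> 'rV[K]_n) :
  linear_form (\sum_i v i) = \sum_i linear_form (v i).
Proof.
rewrite /linear_form exchange_big; apply: eq_bigr => j _ /=.
by rewrite summxE scaler_suml.
Qed.

(** The strict bound lets an induction on [d] start from the zero polynomial. *)
Definition deg_lt {K : fieldType} {n : nat} (d : nat) (p : {mpoly K[n]}) :
    Prop :=
  forall m : 'X_{1..n}, (d <= mdeg m)%N -> p@_m = 0.

Definition euler {K : fieldType} {n : nat} (p : {mpoly K[n]}) : {mpoly K[n]} :=
  \sum_j 'X_j * p^`M(j).

Lemma euler_linear {K : fieldType} {n : nat} : linear (@euler K n).
Proof.
move=> c p q; rewrite /euler scaler_sumr -big_split; apply: eq_bigr => j _ /=.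
by rewrite linearP mulrDr scalerAr.
Qed.

HB.instance Definition _ (K : fieldType) (n : nat) :=
  GRing.isLinear.Build K {mpoly K[n]} {mpoly K[n]} _ (@euler K n) euler_linear.

Lemma eulerX {K : fieldType} {n : nat} (m : 'X_{1..n}) :
  euler 'X_[K, m] = (mdeg m)%:R *: 'X_[m].
Proof.
rewrite /euler mdegE natr_sum scaler_suml; apply: eq_bigr => j _.
(* When [m j] is 0 the subtraction in [m - U_(j)] truncates, but its coefficient vanishes. *)
rewrite mderivX -scalerAr; case: (posnP (m j)) => [->|m_gt0].
  by rewrite !scale0r.
by rewrite -mpolyXD addmC submK // lep1mP -lt0n.
Qed.

Lemma mcoeff_euler {K : fieldType} {n : nat} (p : {mpoly K[n]}) m :
  (euler p)@_m = (mdeg m)%:R * p@_m.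
Proof.
rewrite [p]mpolyE (linear_sum (@euler K n)) !(raddf_sum (mcoeff m)).
rewrite mulr_sumr; apply: eq_bigr => k _ /=.
rewrite (linearZ _ 'X_[k]) /= eulerX scalerA !mcoeffZ !mcoeffX.
by case: eqP => [->|]; rewrite ?mulr0 ?mulr1 // mulrC.
Qed.

(** A partial derivative lowers the degree by one, hence the extra term. Linear relations between
    the partial derivatives of [p] thus pass to those of [euler p]. *)
Lemma mderiv_euler {K : fieldType} {n : nat} (p : {mpoly K[n]}) i :
  (euler p)^`M(i) = p^`M(i) + euler p^`M(i).
Proof.
apply/mpolyP => m; rewrite mcoeffD mcoeff_euler !mcoeff_deriv mcoeff_euler.
by rewrite mdegD mdeg1 addn1 -mulrnAr -natr1 mulrDl mul1r addrC.
Qed.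

(* [euler p = \sum_j 'X_j * p_j] becomes [\sum_i linear_form (row i A) * p_i],
   where [p_i] again satisfies the hypothesis and has lower degree. *)
Lemma diff_nil_grad {K : fieldType} {n : nat} (F : polymap K n)
    (charK0 : [pchar K] =i pred0) (A : 'M[K]_n) :
  (forall i, diff_nil (comp_mpoly F) (linear_form (row i A))) ->
  forall p, (forall j, p^`M(j) = \sum_i A i j *: p^`M(i)) ->
  diff_nil (comp_mpoly F) p.
Proof.
move=> nilA p; have: deg_lt (msize p) p.
  by move=> m /msize_mdeg_ge; apply: memN_msupp_eq0.
move: (msize p) => d; elim: d p => [|d IHd] p degp gradp.
  by exists 0%N; apply/mpolyP => m; rewrite mcoeff0 degp.
case: (posnP d) => [d0|d_gt0].
  suff -> : p = (p@_0)%:MP by apply: diff_nilC.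
  apply/mpolyP => m; rewrite mcoeffC; case: eqP => [->|m0].
    by rewrite mulr1.
  by rewrite mulr0 degp // d0 lt0n mdeg_eq0; apply/eqP.
have nilE : diff_nil (comp_mpoly F) (euler p).
  suff -> : euler p = \sum_i linear_form (row i A) * p^`M(i).
    apply: diff_nil_sum => i _; apply: diff_nilM => //; apply: IHd.
      move=> m dm; rewrite mcoeff_deriv degp ?mul0rn //.
      by rewrite mdegD mdeg1 addn1.
    move=> j; rewrite mderiv_comm gradp linear_sum; apply: eq_bigr => k _ /=.
    by rewrite linearZ /= mderiv_comm.
  rewrite /euler /linear_form.
  under [RHS]eq_bigr do rewrite mulr_suml.
  rewrite exchange_big; apply: eq_bigr => j _ /=.
  rewrite {1}gradp mulr_sumr; apply: eq_bigr => i _.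
  by rewrite mxE -scalerAl -scalerAr.
(* Here [p] has degree at most [d], and the subtraction cancels its part of degree [d]. *)
have nilr : diff_nil (comp_mpoly F) (euler p - d%:R *: p).
  apply: IHd => [m|j].
    rewrite leq_eqVlt mcoeffB mcoeffZ mcoeff_euler => /predU1P[->|dm].
      by rewrite subrr.
    by rewrite degp // !mulr0 subrr.
  rewrite mderivB mderivZ mderiv_euler.
  under eq_bigr do rewrite mderivB mderivZ mderiv_euler.
  under eq_bigr do rewrite scalerBr scalerDr scalerA mulrC -scalerA.
  rewrite sumrB big_split /= -scaler_sumr -gradp {2}gradp linear_sum /=.
  by under [in LHS]eq_bigr do rewrite linearZ.
(* Characteristic zero allows division by [d], which recovers [p] from [nilE] and [nilr]. *)
have dK : d%:R != 0 :> K by rewrite (GRing.pcharf0P K).1 ?lt0n_neq0.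
have -> : p = d%:R^-1 *: (euler p - (euler p - d%:R *: p)).
  by rewrite opprB addrCA subrr addr0 scalerA mulVf ?scale1r.
apply/diff_nilZ/diff_nilD => //; rewrite -scaleN1r; exact: diff_nilZ.
Qed.

(** * Isolating one block of variables *)

Lemma rmorph_comp_mpoly {R : comNzRingType} {S : comNzRingType} {n k : nat}
    (f : {rmorphism {mpoly R[k]} -> S}) (t : n.-tuple {mpoly R[k]})
    (p : {mpoly R[n]}) :
  f (p \mPo t) = mmap (f \o @mpolyC k R) (fun i => f (tnth t i)) p.
Proof.
rewrite /comp_mpoly /mmap rmorph_sum; apply: eq_bigr => m _ /=.
rewrite rmorphM rmorph_prod; congr (_ * _).
by apply: eq_bigr => i _; rewrite rmorphXn.
Qed.

Lemma mmap_eqr {R S : nzRingType} {n : nat} (f : R -> S) (h1 h2 : 'I_n -> S) p :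
  h1 =1 h2 -> mmap f h1 p = mmap f h2 p.
Proof.
by move=> eqh; apply: eq_bigr => m _; congr (_ * _); apply: eq_bigr => i _;
  rewrite eqh.
Qed.

(* Views K[Y^(1),..,Y^(n)] inside K[Y^(1),..,Y^(n)][X] by turning the k-th
   block of variables into X, all others becoming constants. *)
Definition splits_block {K : fieldType} {n : nat} (k : 'I_n)
    (f : {rmorphism {mpoly K[n * n]} -> {mpoly {mpoly K[n * n]}[n]}}) : Prop :=
  (forall c : K, f c%:MP = c%:MP%:MP) /\
  (forall l i, f (tnth (var_block K l) i) =
     if l == k then 'X_i else (tnth (var_block K l) i)%:MP).

(** The images of the variables form a table indexed by block and position; [mxvec] flattens it
    consistently with [mxvec_index]. *)
Lemma splits_block_exists {K : fieldType} {n : nat} (k : 'I_n) :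
  exists f, @splits_block K n k f.
Proof.
exists (mmap (@mpolyC n _ \o @mpolyC (n * n) K)
  (fun l => mxvec (\matrix_(i, j)
     if i == k then 'X_j else ('X_(mxvec_index i j))%:MP) 0 l)).
split=> [c|l i]; first exact: mmapC.
by rewrite tnth_mktuple /= mmapX mmap1U mxvecE mxE.
Qed.

Lemma splits_block_comp {K : fieldType} {n : nat} (k : 'I_n) f
    (t : n.-tuple {mpoly K[n * n]}) (p : {mpoly K[n]}) :
  splits_block k f ->
  f (p \mPo t) = mmap (@mpolyC n _ \o @mpolyC (n * n) K)
                   (fun i => f (tnth t i)) p.
Proof.
case=> fC _; rewrite (rmorph_comp_mpoly f).
by apply: eq_bigr => m _; rewrite /= fC.
Qed.

Lemma splits_block_same {K : fieldType} {n : nat} (k : 'I_n) f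
    (p : {mpoly K[n]}) :
  splits_block k f ->
  f (p \mPo var_block K k) = map_mpoly (@mpolyC (n * n) K) p.
Proof.
move=> fk; rewrite (splits_block_comp _ _ _ _ fk).
by apply: mmap_eqr => i; rewrite fk.2 eqxx.
Qed.

Lemma splits_block_other {K : fieldType} {n : nat} (k l : 'I_n) f
    (p : {mpoly K[n]}) :
  splits_block k f -> l != k ->
  f (p \mPo var_block K l) = (p \mPo var_block K l)%:MP.
Proof.
move=> fk lk; rewrite (splits_block_comp _ _ _ _ fk).
pose g : {rmorphism {mpoly K[n * n]} -> {mpoly {mpoly K[n * n]}[n]}} :=
  @mpolyC n {mpoly K[n * n]}.
rewrite -[RHS]/(g _) (rmorph_comp_mpoly g).
by apply: mmap_eqr => i; rewrite fk.2 (negPf lk).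
Qed.

(** * Peeling factors off the product of Jacobians *)

Definition block_prod {K : fieldType} {n : nat} (A : 'M[{mpoly K[n]}]_n)
    (s : seq 'I_n) : 'M[{mpoly K[n * n]}]_n :=
  \big[mulmx/1%:M]_(k <- s) mx_at_block A k.

Lemma splits_block_prod {K : fieldType} {n : nat} (A : 'M[{mpoly K[n]}]_n)
    (k : 'I_n) f (s : seq 'I_n) :
  splits_block k f -> k \notin s ->
  map_mx f (block_prod A s)
    = map_mx (@mpolyC n {mpoly K[n * n]}) (block_prod A s).
Proof.
move=> fk; rewrite /block_prod; elim: s => [|l s IHs].
  by rewrite big_nil (map_mx1 f) (map_mx1 (@mpolyC n {mpoly K[n * n]})).
rewrite inE negb_or eq_sym big_cons => /andP[lk ks].
rewrite (map_mxM f) IHs // (map_mxM (@mpolyC n {mpoly K[n * n]})).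
by congr (_ *m _); apply/matrixP => i j; rewrite !mxE (splits_block_other k).
Qed.

Lemma mcoeff_mulmx {R : comNzRingType} {n a b c d : nat} (m : 'X_{1..n})
    (B : 'M[R]_(a, b)) (M : 'M[{mpoly R[n]}]_(b, c)) (C : 'M[R]_(c, d)) :
  map_mx (mcoeff m) (map_mx (@mpolyC n R) B *m M *m map_mx (@mpolyC n R) C)
    = B *m map_mx (mcoeff m) M *m C.
Proof.
apply/matrixP => i j; rewrite !mxE raddf_sum; apply: eq_bigr => l _ /=.
rewrite !mxE mulrC mcoeffCM mulrC; congr (_ * _).
by rewrite raddf_sum; apply: eq_bigr => l' _; rewrite /= !mxE mcoeffCM.
Qed.

(** Once block [k] is split off, [B] and the blocks in [s] are constant in the new variables, so
    taking the coefficient at [m] affects only the factor of block [k]. *)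
Lemma block_prod_coef {K : fieldType} {n : nat} (A : 'M[{mpoly K[n]}]_n)
    (k : 'I_n) (s : seq 'I_n) (B : 'M[K]_n) (m : 'X_{1..n}) :
  k \notin s ->
  map_mx (@mpolyC (n * n) K) B *m block_prod A (k :: s) = 0 ->
  map_mx (@mpolyC (n * n) K) (B *m map_mx (mcoeff m) A) *m block_prod A s = 0.
Proof.
move=> ks; have [f fk] := @splits_block_exists K n k.
move=> /(congr1 (map_mx f)); rewrite (map_mx0 f).
rewrite [block_prod A (k :: s)]big_cons -/(block_prod A s) mulmxA.
rewrite !(map_mxM f) (splits_block_prod _ _ _ _ fk) //.
have -> : map_mx f (map_mx (@mpolyC (n * n) K) B)
    = map_mx (@mpolyC n {mpoly K[n * n]}) (map_mx (@mpolyC (n * n) K) B).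
  by apply/matrixP => i j; rewrite !mxE fk.1.
move=> /(congr1 (map_mx (mcoeff m))).
rewrite mcoeff_mulmx (map_mx0 (mcoeff m)) (map_mxM (@mpolyC (n * n) K)).
have -> // : map_mx (mcoeff m) (map_mx f (mx_at_block A k))
    = map_mx (@mpolyC (n * n) K) (map_mx (mcoeff m) A).
by apply/matrixP => i j; rewrite !mxE (splits_block_same k) // mcoeff_map_mpoly.
Qed.

Lemma diff_nil_block_prod {K : fieldType} {n : nat} (F : polymap K n)
    (charK0 : [pchar K] =i pred0) (s : seq 'I_n) (B : 'M[K]_n) :
  uniq s ->
  map_mx (@mpolyC (n * n) K) B
    *m block_prod (jacobian (polymap_sub F (polymap_id K n))) s = 0 ->
  forall i, diff_nil (comp_mpoly F) (linear_form (row i B)).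
Proof.
set A := jacobian _; elim: s B => [|k s IHs] B /=.
  rewrite /block_prod big_nil mulmx1 => _ B0 i; exists 0%N.
  rewrite /= /linear_form big1 // => j _; rewrite mxE.
  move/matrixP: B0 => /(_ i j); rewrite !mxE => /eqP.
  by rewrite mpolyC_eq0 => /eqP ->; rewrite scale0r.
case/andP=> ks us B0 i.
have nilBA m v : (v <= B *m map_mx (mcoeff m) A)%MS ->
  diff_nil (comp_mpoly F) (linear_form v).
  case/submxP=> w ->; rewrite linear_form_mulmx; apply: diff_nil_sum => l _.
  apply/diff_nilZ/IHs => //; exact: (block_prod_coef _ _ _ _ m ks B0).
(* This is [diff] of the linear form of row [i], as the end of the proof checks. *)
pose p := \sum_l B i l *: tnth (polymap_sub F (polymap_id K n)) l.
have pE m : \row_j (p^`M(j))@_m = row i (B *m map_mx (mcoeff m) A).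
  apply/rowP => j; rewrite !mxE /p (linear_sum (mderiv j)).
  rewrite (raddf_sum (mcoeff m)); apply: eq_bigr => l _.
  by rewrite /= linearZ /= mcoeffZ !mxE.
pose d := msize p.
(* Monomials of degree below [msize p] suffice: the gradient of [p] has no others. *)
pose W := (\sum_(m : 'X_{1..n < d}) <<B *m map_mx (mcoeff m) A>>)%MS.
have nilW v : (v <= W)%MS -> diff_nil (comp_mpoly F) (linear_form v).
  case/sub_sumsmxP => w ->; rewrite linear_form_sum; apply: diff_nil_sum => m _.
  by apply: (nilBA m); rewrite -(genmxE (B *m _)) submxMl.
have gradW m : (\row_j (p^`M(j))@_m <= W)%MS.
  case: (ltnP (mdeg m) d) => [md|dm].
    rewrite pE; apply: submx_trans (row_sub _ _) _.
    by apply: (sumsmx_sup (BMultinom md)) => //; rewrite genmxE.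
  suff -> : \row_j (p^`M(j))@_m = 0 by apply: sub0mx.
  apply/rowP => j; rewrite !mxE mcoeff_deriv memN_msupp_eq0 ?mul0rn //.
  by apply: msize_mdeg_ge; rewrite mdegD (leq_trans dm) ?leq_addr.
have nilp : diff_nil (comp_mpoly F) p.
  (* [pinvmx W *m W] has its rows in [W] and fixes every row vector of [W], in particular the
     coefficient vectors of the gradient. *)
  apply: (diff_nil_grad F charK0 (pinvmx W *m W)) => [l|j].
    by apply: nilW; rewrite (submx_trans (row_sub _ _)) ?submxMl.
  apply/mpolyP => m; rewrite [RHS](raddf_sum (mcoeff m)).
  have /rowP/(_ j) := mulmxKpV (gradW m); rewrite -mulmxA !mxE => <-.
  by apply: eq_bigr => l _; rewrite /= mxE mcoeffZ mulrC.
case: nilp => a pa; exists a.+1; rewrite iterSr -[RHS]pa; congr iter.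
rewrite /diff /linear_form /= raddf_sum -sumrB; apply: eq_bigr => l _ /=.
by rewrite comp_mpolyZ comp_mpolyXU -tnth_nth !tnth_mktuple mxE scalerBr.
Qed.

Theorem theorem5p1 (K : fieldType) (charK0 : [pchar K] =i pred0)
    (n : nat) (n_gt0 : (1 <= n)%N) (F H : polymap K n)
    (F_def : forall i : 'I_n, tnth F i = 'X_i + tnth H i)
    (H_order : forall i : 'I_n, vanishing_order_ge 2 (tnth H i)) :
  strongly_nilpotent F -> pascal_finite F.
Proof.
move=> nilF.
have nilX i : diff_nil (comp_mpoly F) ('X_i : {mpoly K[n]}).
  suff -> : 'X_i = linear_form (row i 1%:M) :> {mpoly K[n]}.
    apply: (diff_nil_block_prod F charK0 (index_enum 'I_n)).
      exact: index_enum_uniq.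
    by rewrite map_mx1 mul1mx; apply: nilF.
  rewrite /linear_form (bigD1 i) //= big1 => [|j ji]; rewrite !mxE.
    by rewrite eqxx scale1r addr0.
  by rewrite eq_sym (negPf ji) scale0r.
have tnth_iter m i : tnth (iter m (Delta F) (polymap_id K n)) i
    = iter m (diff (comp_mpoly F)) 'X_i.
  elim: m => [|m IHm] /=; first by rewrite tnth_mktuple.
  by rewrite !tnth_mktuple IHm.
have [e nile] := fin_all_exists nilX; pose M := (\max_i e i)%N.
(* The maximum serves all coordinates at once; the successor makes the exponent positive. *)
exists M.+1; split=> //; apply: eq_from_tnth => i.
by rewrite tnth_iter tnth_mktuple (iter_diff_leq _ (e i)) // leqW ?leq_bigmax.
Qed.
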